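(* Let $A$, $Q$, $q$, $\sigma$, $H_{A,Q}$, $W=\langle\mathfrak S(Q),\sigma\rangle$ and $F$ be as in the context. Then: (1) If $[W,W]\cap\mathfrak S(Q)=[\mathfrak S(Q),\mathfrak S(Q)]$ then $F\simeq \mathfrak S(Q)/[\mathfrak S(Q),\mathfrak S(Q)]=:\mathfrak S(Q)_{\mathrm{ab}}$. In particular, if $\sigma\in\mathfrak S(Q)$ then $F\simeq\mathfrak S(Q)_{\mathrm{ab}}$. (2) If $\mathfrak S(Q)=\langle\tau\rangle$ with $\tau\in\mathcal S_q\setminus\mathcal A_q$ an involution, then $F\simeq\mathfrak S(Q)$. (3) If $\mathfrak S(Q)=[\mathfrak S(Q),\mathfrak S(Q)]$ then $F=\{\mathrm{Id}\}$. In particular, if $\mathfrak S(Q)=\mathcal A_q$ with $q\ge5$ then $F=\{\mathrm{Id}\}$.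
   Context: An interval exchange transformation (iet) is a bijection $f:[0,1)\to[0,1)$ for which there is a finite partition of $[0,1)$ into half-open intervals $[a,b)$ on each of which $f$ is a translation. The iets form a group $\mathrm{IET}$ under composition. For $a\in\mathbb R/\mathbb Z$, $R_a\in\mathrm{IET}$ is the rotation $x\mapsto x+a \bmod 1$. For an integer $q\ge 1$ let $I_i=[\frac{i-1}{q},\frac{i}{q})$, $1\le i\le q$. For $\tau$ in the symmetric group $\mathcal S_q$ on $\{1,\dots,q\}$, $E_\tau$ is the iet that is a translation on each $I_i$ with $E_\tau(I_i)=I_{\tau(i)}$. Put $\mathcal G_{1/q}=\{E_\tau:\tau\in\mathcal S_q\}$; the map $\mathfrak S:\mathcal G_{1/q}\to\mathcal S_q$, $E_\tau\mapsto\tau$, is an isomorphism. $\sigma=\sigma_q$ is the $q$-cycle $(1,2,\dots,q)\in\mathcal S_q$, and $\mathcal A_q$ is the alternating group. Setup: $s,m,q\geq 1$ are integers; $\alpha_1,\dots,\alpha_s\in(\mathbb R/\mathbb Z)\setminus(\mathbb Q/\mathbb Z)$ are $\mathbb Q$-independent (i.e. $\sum n_i\alpha_i=0$ in $\mathbb R/\mathbb Z$ with $n_i\in\mathbb Z$ forces all $n_i=0$; equivalently, for real representatives, $1,\alpha_1,\dots,\alpha_s$ are linearly independent over $\mathbb Q$); $A=\langle\alpha_1,\dots,\alpha_s\rangle\simeq\mathbb Z^s$ is the subgroup of $\mathbb R/\mathbb Z$ they generate; $g_1,\dots,g_m\in\mathcal G_{1/q}$ and $Q=\langle g_1,\dots,g_m\rangle\le\mathcal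 G_{1/q}$; and $H_{A,Q}=\langle R_{\alpha_1},\dots,R_{\alpha_s},g_1,\dots,g_m\rangle\le\mathrm{IET}$. The group $F$: the abelianization $H_{A,Q}/[H_{A,Q},H_{A,Q}]$ is isomorphic to $F\times A$, where $F$ is a finite abelian group which is a quotient $\mathfrak S(Q)/N_Q$ by a normal subgroup $N_Q$ with $[\mathfrak S(Q),\mathfrak S(Q)]\le N_Q\le[W,W]\cap\mathfrak S(Q)$. (Up to isomorphism $F$ is the torsion subgroup of the abelianization of $H_{A,Q}$.) *)

(* Defs.v *)
From HB Require Import structures.
From mathcomp Require Import all_boot all_order all_fingroup all_algebra all_solvable.
From mathcomp Require Import generic_quotient ring_quotient.
From mathcomp Require Import boolp classical_sets reals.
From mathcomp Require Import ring lra.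

Set Implicit Arguments.
Unset Strict Implicit.
Unset Printing Implicit Defensive.

Import Order.TTheory GRing.Theory Num.Theory.
Import Quotient.Exports.

Local Open Scope classical_set_scope.
Local Open Scope ring_scope.

Section Generated.
Variable G : groupType.
Local Open Scope group_scope.

Definition gen (X : set G) : {pred G} := fun x =>
  `[< forall K : {pred G}, group_closed K -> (forall y, X y -> y \in K) ->
        x \in K >].

Lemma gen_group_closed X : group_closed (gen X).
Proof.
split=> [|x y /asboolP xX /asboolP yX]; apply/asboolP => K gK XK.
  by case: gK.
by case: (gK) => _; apply; [apply: xX | apply: yX].
Qed.

HB.instance Definition _ X :=
  isMulClosed.Build G (gen X) (group_closedM (gen_group_closed X)).
HB.instance Definition _ X :=
  isMul1Closed.Build G (gen X) (gen_group_closed X).1.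
HB.instance Definition _ X :=
  isInvClosed.Build G (gen X) (group_closedV (gen_group_closed X)).

Lemma sub_gen X x : X x -> x \in gen X.
Proof. by move=> Xx; apply/asboolP => K _; apply. Qed.

Lemma gen_min X (K : {pred G}) :
  group_closed K -> (forall y, X y -> y \in K) -> {subset gen X <= K}.
Proof. by move=> gK XK x /asboolP; apply. Qed.

Definition commutators : set G := [set [~ x, y] | x in setT & y in setT].

Definition der : {pred G} := gen commutators.
HB.instance Definition _ := GroupClosed.on der.

Lemma derJ x y : x \in der -> x ^ y \in der.
Proof.
move=> xD; rewrite -(mulKVg x (x ^ y)); apply: gpredM => //.
by apply: sub_gen; exists x => //; exists y.
Qed.

End Generated.

Arguments commutators G : clear implicits.
Arguments der G : clear implicits.

Section Subgroup.
Variables (G : groupType) (S : groupClosed G).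

Record subgroup := Subgroup { subg_val : G; _ : subg_val \in (S : {pred G}) }.

HB.instance Definition _ := [isSub for subg_val].
HB.instance Definition _ := [Choice of subgroup by <:].

Fact subgroup_closed : group_closed (fun x : G => x \in (S : {pred G})).
Proof. by split=> [|x y]; [exact: gpred1 | exact: gpredF]. Qed.

HB.instance Definition _ :=
  SubChoice_isSubGroup.Build G _ subgroup subgroup_closed.

End Subgroup.

Section Abelianization.
Variable G : groupType.
Local Open Scope group_scope.
Local Open Scope quotient_scope.

Definition ab_rel (x y : G) := x^-1 * y \in der G.

Fact ab_rel_equiv : equiv_class_of ab_rel.
Proof.
rewrite /ab_rel; split=> [x|x y|y x z].
- by rewrite mulVg gpred1.
- by rewrite -gpredV invgM invgK.
- by move=> xy yz; rewrite -(mulVKg y z) mulgA gpredM.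
Qed.

Canonical ab_equiv := EquivRelPack ab_rel_equiv.
Canonical ab_encModRel := defaultEncModRel ab_rel.

Definition abelianization := {eq_quot ab_rel}.

HB.instance Definition _ := EqQuotient.on abelianization.
HB.instance Definition _ := Choice.on abelianization.

Definition ab_one : abelianization :=
  \pi_abelianization 1.
Definition ab_mul (a b : abelianization) : abelianization :=
  \pi_abelianization (repr a * repr b).
Definition ab_inv (a : abelianization) : abelianization :=
  \pi_abelianization (repr a)^-1.

Lemma pi_abE (x y : G) :
  (\pi_abelianization x = \pi_abelianization y) <-> ab_rel x y.
Proof. by split=> [/eqmodP//|h]; apply/eqmodP. Qed.

Lemma repr_ab (x : G) : ab_rel (repr (\pi_abelianization x)) x.
Proof. by apply/pi_abE; rewrite reprK. Qed.

Lemma ab_mulE x y : ab_mul (\pi x) (\pi y) = \pi_abelianization (x * y).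
Proof.
apply/pi_abE; have := repr_ab x; have := repr_ab y; rewrite /ab_rel.
move: (repr _) (repr _) => x' y' hy hx.
have -> : (x' * y')^-1 * (x * y) = (y'^-1 * y) * ((x'^-1 * x) ^ y).
  by rewrite /conjg invgM -!mulgA mulVKg.
by apply: gpredM => //; apply: derJ.
Qed.

Lemma ab_invE x : ab_inv (\pi x) = \pi_abelianization x^-1.
Proof.
apply/pi_abE; have := repr_ab x; rewrite /ab_rel.
move: (repr _) => x' hx; rewrite invgK -gpredV invgM invgK.
have -> : x * x'^-1 = (x'^-1 * x) ^ x^-1 by rewrite /conjg invgK !mulgA mulgK.
exact: derJ.
Qed.

Fact ab_mulA : associative ab_mul.
Proof.
by move=> a b c; rewrite -[a]reprK -[b]reprK -[c]reprK !ab_mulE mulgA.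
Qed.
Fact ab_mul1 : left_id ab_one ab_mul.
Proof. by move=> a; rewrite -[a]reprK ab_mulE mul1g. Qed.
Fact ab_mul1r : right_id ab_one ab_mul.
Proof. by move=> a; rewrite -[a]reprK ab_mulE mulg1. Qed.
Fact ab_mulV : left_inverse ab_one ab_inv ab_mul.
Proof. by move=> a; rewrite -[a]reprK ab_invE ab_mulE mulVg. Qed.
Fact ab_mulVr : right_inverse ab_one ab_inv ab_mul.
Proof. by move=> a; rewrite -[a]reprK ab_invE ab_mulE mulgV. Qed.

HB.instance Definition _ := isGroup.Build abelianization
  ab_mulA ab_mul1 ab_mul1r ab_mulV ab_mulVr.

End Abelianization.

Definition isomorphic (G H : groupType) : Prop :=
  exists f : {multiplicative G -> H}, bijective f.


Section Iet.
Variable R : realType.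

Definition int_pred : {pred R} := fun x => x \is a Num.int.
HB.instance Definition _ :=
  GRing.isSubringClosed.Build R int_pred (Num.Theory.int_num_subring R).

Definition circle := Quotient.quot int_pred.
HB.instance Definition _ := EqQuotient.on circle.
HB.instance Definition _ := GRing.Zmodule.on circle.

Record unit_ico := UnitIco { ico_val :> R; _ : ico_val \in `[0, 1[ }.
HB.instance Definition _ := [isSub for ico_val].
HB.instance Definition _ := [Choice of unit_ico by <:].

(* P lists the intervals [a, b) of the partition; the count condition says that
   they cover [0, 1) and are pairwise disjoint. *)
Definition is_iet (f : unit_ico -> unit_ico) : Prop :=
  bijective f /\
  exists P : seq (R * R),
    [/\ forall p, p \in P -> [/\ 0 <= p.1, p.1 < p.2 & p.2 <= 1],
        forall x : unit_ico, count (fun p => val x \in `[p.1, p.2[) P = 1%N &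
        forall p, p \in P -> exists t : R, forall x : unit_ico,
          val x \in `[p.1, p.2[ -> val (f x) = val x + t].

Record iet := Iet { iet_fun :> unit_ico -> unit_ico; _ : `[< is_iet iet_fun >] }.
HB.instance Definition _ := [isSub for iet_fun].
HB.instance Definition _ := [Choice of iet by <:].

Lemma ietP (f : iet) : is_iet f. Proof. by case: f => f /= /asboolP. Qed.

Lemma iet_ext (f g : iet) : f =1 g -> f = g.
Proof. by move=> fg; apply/val_inj/funext. Qed.

Lemma choice_in (T : eqType) (U : Type) (u0 : U) (s : seq T) (Pr : T -> U -> Prop) :
  (forall x, x \in s -> exists u, Pr x u) ->
  exists f : T -> U, forall x, x \in s -> Pr x (f x).
Proof.
move=> h; suff /boolp.choice[f] : forall x, exists u, x \in s -> Pr x u.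
  by exists f.
by move=> x; case xs: (x \in s); [have [u] := h x xs; exists u | exists u0].
Qed.

Definition mk_iet f (fP : is_iet f) : iet := Iet (introT (asboolP _) fP).

Lemma unit_icoP (x : unit_ico) : 0 <= val x < 1.
Proof. by have := valP x; rewrite in_itv. Qed.

(* A covering by pairwise disjoint intervals given as a sequence in which
   empty intervals are allowed. *)
Lemma iet_weaken (f : unit_ico -> unit_ico) (P : seq (R * R)) :
  bijective f ->
  (forall p, p \in P -> 0 <= p.1 /\ p.2 <= 1) ->
  (forall x : unit_ico, count (fun p => val x \in `[p.1, p.2[) P = 1%N) ->
  (forall p, p \in P -> exists t : R, forall x : unit_ico,
      val x \in `[p.1, p.2[ -> val (f x) = val x + t) ->
  is_iet f.
Proof.
move=> bf P01 Pc Pt; split=> //; exists [seq p <- P | p.1 < p.2]; split.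
- by move=> p; rewrite mem_filter => /andP[p12 /P01[]].
- move=> x; rewrite count_filter -[RHS](Pc x); apply: eq_count => p /=.
  rewrite in_itv /=; case: (ltP p.1 p.2) => //= [_|p21]; rewrite ?andbT ?andbF //.
  by symmetry; apply/negbTE/negP => /andP[/le_lt_trans h /h]; rewrite ltNge p21.
- by move=> p; rewrite mem_filter => /andP[_ /Pt].
Qed.

Lemma is_iet_id : is_iet id.
Proof.
apply: (@iet_weaken _ [:: (0, 1)]); first by exists id.
- by move=> p; rewrite inE => /eqP -> /=.
- by move=> x /=; rewrite (valP x).
- by move=> p _; exists 0 => x _; rewrite addr0.
Qed.

Lemma count_allpairs (T1 T2 : eqType) (T : Type) (h : T1 -> T2 -> T)
    (a : pred T) (a1 : pred T1) (a2 : pred T2) s t :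
  {in s, forall x y, a (h x y) = a1 x && a2 y} ->
  count a [seq h x y | x <- s, y <- t] = (count a1 s * count a2 t)%N.
Proof.
elim: s => //= x s IH ha; rewrite count_cat IH => [|z zs]; last first.
  by apply: ha; rewrite inE zs orbT.
have {}ha y : a (h x y) = a1 x && a2 y by apply: ha; rewrite inE eqxx.
rewrite mulnDl count_map; congr (_ + _)%N; case a1x: (a1 x).
  by rewrite mul1n; apply: eq_count => y /=; rewrite ha a1x.
by rewrite mul0n (@eq_count _ _ pred0) ?count_pred0// => y /=; rewrite ha a1x.
Qed.

Lemma is_iet_comp f g : is_iet f -> is_iet g -> is_iet (g \o f).
Proof.
move=> [bf [P [P01 Pc /(choice_in 0) Pt]]] [bg [S [S01 Sc St]]].
have [t tP] := Pt.
pose h (p s : R * R) := (Num.max p.1 (s.1 - t p), Num.min p.2 (s.2 - t p)).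
have hE p s (x : R) : (x \in `[(h p s).1, (h p s).2[) =
    (x \in `[p.1, p.2[) && (x + t p \in `[s.1, s.2[).
  rewrite !in_itv /= ge_max lt_min lerBlDr ltrBrDr.
  by rewrite -!andbA; congr (_ && _); rewrite andbCA.
apply: (@iet_weaken _ [seq h p s | p <- P, s <- S]).
- exact: bij_comp.
- move=> _ /allpairsP[[p s] /= [/P01[p0 p12 p1] _ ->]] /=.
  by rewrite le_max ge_min p0 p1.
- move=> x; rewrite (@count_allpairs _ _ _ _ _
    (fun p => val x \in `[p.1, p.2[) (fun s => val (f x) \in `[s.1, s.2[)).
    by rewrite Pc Sc.
  move=> p pP s; rewrite hE; case xp: (val x \in `[p.1, p.2[) => //=.
  by rewrite (tP _ pP).
- move=> _ /allpairsP[[p s] /= [pP /St[u uP] ->]]; exists (t p + u) => x.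
  by rewrite hE => /andP[xp]; rewrite -(tP _ pP)// addrA -(tP _ pP)// => /uP.
Qed.

Lemma is_iet_inv f g : is_iet f -> cancel f g -> cancel g f -> is_iet g.
Proof.
move=> [bf [P [P01 Pc /(choice_in 0)[t tP]]]] fg gf.
have in01 p (x : R) : p \in P -> x \in `[p.1, p.2[ -> x \in `[0, 1[.
  move=> /P01[p0 p12 p1]; rewrite !in_itv /= => /andP[px xp].
  by rewrite (le_trans p0 px) (lt_le_trans xp p1).
have tP' p (x : R) : p \in P -> x \in `[p.1, p.2[ ->
    exists2 y : unit_ico, val y = x & val (f y) = x + t p.
  by move=> pP xp; exists (UnitIco (in01 _ _ pP xp)); rewrite ?(tP _ pP).
pose h p := (p.1 + t p, p.2 + t p).
have hE p y : p \in P ->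
    (val y \in `[(h p).1, (h p).2[) = (val (g y) \in `[p.1, p.2[).
  move=> pP; apply/idP/idP => [|gyp].
    rewrite in_itv /= -lerBrDr -ltrBlDr => yp.
    have [|z zE] := @tP' p (val y - t p) pP; first by rewrite in_itv.
    by rewrite subrK => /val_inj <-; rewrite fg zE in_itv.
  by move: (gyp); rewrite -[in X in _ -> X](gf y) (tP _ pP)// !in_itv /= lerD2r ltrD2r.
apply: (@iet_weaken _ [seq h p | p <- P]).
- by exists f.
- move=> _ /mapP[p pP ->] /=; have [p0 p12 p1] := P01 _ pP; split.
    have [|y _ <-] := @tP' p p.1 pP; first by rewrite in_itv /= lexx.
    by case/andP: (unit_icoP (f y)).
  rewrite leNgt; apply/negP => lt1.
  have [|y yE fyE] := @tP' p (Num.max p.1 (1 - t p)) pP.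
    by rewrite in_itv /= le_max lexx gt_max p12 ltrBlDr.
  have /andP[_] := unit_icoP (f y); rewrite fyE ltNge -lerBlDr.
  by rewrite le_max lexx orbT.
- move=> x; rewrite count_map -[RHS](Pc (g x)); apply: eq_in_count => p pP.
  exact: hE.
- move=> _ /mapP[p pP ->]; exists (- t p) => x; rewrite hE// => /(tP _ pP).
  by rewrite gf => ->; rewrite addrK.
Qed.

Definition iet_one : iet := mk_iet is_iet_id.
Definition iet_mul (f g : iet) : iet := mk_iet (is_iet_comp (ietP f) (ietP g)).

Fact iet_inv_subproof (f : iet) :
  { g : iet | cancel f g & cancel g f }.
Proof.
apply: cid2; have [[g fg gf] _] := ietP f.
by exists (mk_iet (is_iet_inv (ietP f) fg gf)).
Qed.
Definition iet_inv (f : iet) : iet := s2val (iet_inv_subproof f).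

Fact iet_mulA : associative iet_mul.
Proof. by move=> f g h; apply: iet_ext. Qed.
Fact iet_mul1 : left_id iet_one iet_mul.
Proof. by move=> f; apply: iet_ext. Qed.
Fact iet_mul1r : right_id iet_one iet_mul.
Proof. by move=> f; apply: iet_ext. Qed.
Fact iet_mulV : left_inverse iet_one iet_inv iet_mul.
Proof.
by move=> f; apply: iet_ext => x /=; rewrite /iet_inv; case: iet_inv_subproof => g /=.
Qed.
Fact iet_mulVr : right_inverse iet_one iet_inv iet_mul.
Proof.
by move=> f; apply: iet_ext => x /=; rewrite /iet_inv; case: iet_inv_subproof => g /=.
Qed.

(* The product f * g is "f, then g", i.e. x |-> g (f x), as for {perm T}. *)
HB.instance Definition _ := isGroup.Build iet
  iet_mulA iet_mul1 iet_mul1r iet_mulV iet_mulVr.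

Fact frac_subproof (y : R) : y - (Num.floor y)%:~R \in `[0, 1[.
Proof.
have /andP[h1 h2] := floor_itv y.
by rewrite in_itv /= subr_ge0 h1 ltrBlDl -[1]/(1%:~R) -intrD.
Qed.
Definition frac (y : R) : unit_ico := UnitIco (frac_subproof y).

Lemma frac_eq (y : R) (x : unit_ico) (n : int) :
  y = val x + n%:~R -> frac y = x.
Proof.
move=> ->; apply/val_inj => /=; rewrite (@floor_def _ _ n) ?addrK//.
have /andP[h1 h2] := unit_icoP x.
by rewrite lerDr h1 intrD addrC ltrD2l.
Qed.

(* x + a mod 1; it does not depend on the representative of a in R. *)
Definition rotation_fun (a : circle) (x : unit_ico) : unit_ico :=
  frac (val x + repr a).

Fact rotation_subproof a : is_iet (rotation_fun a).
Proof.
rewrite /rotation_fun; move: (repr a) => b.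
pose n := Num.floor b; pose c : R := val (frac b).
have bE : b = c + n%:~R by rewrite /c /= subrK.
have /andP[c0 c1] : 0 <= c < 1 by exact: unit_icoP.
apply: (@iet_weaken _ [:: (0, 1 - c); (1 - c, 1)]).
- exists (fun x => frac (val x - b)) => x /=.
    by apply: (@frac_eq _ _ (- Num.floor (val x + b))); rewrite /= mulrNz; ring.
  by apply: (@frac_eq _ _ (- Num.floor (val x - b))); rewrite /= mulrNz; ring.
- by move=> p; rewrite !inE => /orP[]/eqP -> /=; split; lra.
- move=> x /=; have /andP[x0 x1] := unit_icoP x.
  by rewrite !in_itv /= x0 x1 andbT addn0; case: ltP.
- move=> p; rewrite !inE => /orP[]/eqP -> /=.
    exists c => x; rewrite in_itv /= => /andP[x0 xc].
    have h : val x + c \in `[0, 1[ by rewrite in_itv /=; apply/andP; split; lra.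
    by apply: (congr1 val (@frac_eq _ (UnitIco h) n _)); rewrite /= bE addrA.
  exists (c - 1) => x; rewrite in_itv /= => /andP[x0 xc].
  have h : val x + (c - 1) \in `[0, 1[.
    by rewrite in_itv /=; apply/andP; split; lra.
  apply: (congr1 val (@frac_eq _ (UnitIco h) (n + 1) _)).
  by rewrite /= bE intrD; ring.
Qed.
Definition rotation (a : circle) : iet := mk_iet (rotation_subproof a).

Section IntervalPerm.
Variable q : nat.
Implicit Types (i j : 'I_q) (s t : 'S_q).

(* 0-based: I_1, ..., I_q are here cell 0, ..., cell (q - 1). *)
Definition cell i : interval R := `[i%:R / q%:R, i.+1%:R / q%:R[.

Lemma cell_uniq i j (x : R) : x \in cell i -> x \in cell j -> i = j.
Proof.
have q0 : (0 : R) < q%:R by rewrite ltr0n (leq_ltn_trans _ (ltn_ord i)).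
rewrite !in_itv /= !ler_pdivrMr// !ltr_pdivlMr// => /andP[i1 i2] /andP[j1 j2].
apply: ord_inj; apply/eqP; rewrite eqn_leq; apply/andP; split.
  by rewrite -ltnS -(ltr_nat R) (le_lt_trans i1 j2).
by rewrite -ltnS -(ltr_nat R) (le_lt_trans j1 i2).
Qed.

Lemma cell_exists (x : unit_ico) : (0 < q)%N -> exists i, val x \in cell i.
Proof.
move=> q_gt0; have q0 : (0 : R) < q%:R by rewrite ltr0n.
have /andP[x0 x1] := unit_icoP x.
have xq : 0 <= val x * q%:R by rewrite mulr_ge0// ltW.
have /andP[h1 h2] := truncn_itv xq.
have hq : (Num.truncn (val x * q%:R) < q)%N.
  by rewrite -(ltr_nat R) (le_lt_trans h1)// gtr_pMl.
by exists (Ordinal hq); rewrite in_itv /= ler_pdivrMr// ltr_pdivlMr// h1 h2.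
Qed.

Lemma cell_sub01 i : (0 : R) <= i%:R / q%:R /\ (i.+1%:R / q%:R : R) <= 1.
Proof.
have q0 : (0 : R) < q%:R by rewrite ltr0n (leq_ltn_trans _ (ltn_ord i)).
by rewrite divr_ge0// ler_pdivrMr// mul1r ler_nat.
Qed.

Definition shift s i (x : R) : R := x + ((s i)%:R - i%:R) / q%:R.

Lemma shift_in s i x : (shift s i x \in cell (s i)) = (x \in cell i).
Proof.
rewrite !in_itv /= /shift -lerBlDr -ltrBrDr -!natr1.
have -> : (s i)%:R / q%:R - ((s i)%:R - i%:R) / q%:R = i%:R / q%:R :> R by ring.
have -> // : ((s i)%:R + 1) / q%:R - ((s i)%:R - i%:R) / q%:R =
    (i%:R + 1) / q%:R :> R.
by ring.
Qed.

(* The default branch is only reached for q = 0, where there are no cells. *)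
Definition E_val s (x : unit_ico) : R :=
  if [pick i | val x \in cell i] is Some i then shift s i (val x) else val x.

Lemma E_valE s (x : unit_ico) i : val x \in cell i -> E_val s x = shift s i (val x).
Proof.
rewrite /E_val => xi; case: pickP => [j xj|/(_ i)]; last by rewrite xi.
by rewrite (cell_uniq xi xj).
Qed.

Fact E_subproof s x : E_val s x \in `[0, 1[.
Proof.
rewrite /E_val; case: pickP => [i|_]; last exact: valP.
rewrite -(shift_in s); have [h1 h2] := cell_sub01 (s i).
rewrite !in_itv /= => /andP[k1 k2].
by rewrite (le_trans h1 k1) (lt_le_trans k2 h2).
Qed.

Definition E_fun s (x : unit_ico) : unit_ico := UnitIco (E_subproof s x).

Lemma E_in s (x : unit_ico) i : val x \in cell i -> val (E_fun s x) \in cell (s i).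
Proof. by move=> xi; rewrite /= (E_valE s xi) shift_in. Qed.

Lemma E_funM s t x : E_fun (s * t)%g x = E_fun t (E_fun s x).
Proof.
apply/val_inj => /=; case: (posnP q) => [q0|/(cell_exists x)[i xi]].
  have noI (y : unit_ico) u : E_val u y = val y.
    by rewrite /E_val; case: pickP => // j; have := ltn_ord j; rewrite {2}q0.
  by rewrite !noI /= noI.
rewrite (E_valE _ (E_in s xi)) /= !(E_valE _ xi) /shift permM; ring.
Qed.

Lemma E_fun1 x : E_fun 1%g x = x.
Proof.
apply/val_inj => /=; rewrite /E_val; case: pickP => // i _.
by rewrite /shift perm1 subrr mul0r addr0.
Qed.

Fact interval_perm_subproof s : is_iet (E_fun s).
Proof.
case: (posnP q) => [q0|q_gt0].
  suff -> : E_fun s = id by exact: is_iet_id.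
  apply/funext => x; apply/val_inj; rewrite /= /E_val.
  by case: pickP => // j; have := ltn_ord j; rewrite {2}q0.
apply: (@iet_weaken _ [seq (i%:R / q%:R, i.+1%:R / q%:R) | i : 'I_q]).
- by exists (E_fun s^-1%g) => x; rewrite -E_funM ?mulgV ?mulVg E_fun1.
- by move=> _ /mapP[i _ ->]; exact: cell_sub01.
- move=> x; have [i xi] := cell_exists x q_gt0; rewrite count_map.
  rewrite (@eq_count _ _ (pred1 i)) ?count_uniq_mem ?enum_uniq ?mem_enum//.
  by move=> j /=; apply/idP/eqP => [xj|->//]; exact: (cell_uniq xj xi).
- move=> _ /mapP[i _ ->]; exists (((s i)%:R - i%:R) / q%:R) => x xi.
  exact: E_valE.
Qed.

Definition interval_perm s : iet := mk_iet (interval_perm_subproof s).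

Lemma interval_permM s t :
  interval_perm (s * t)%g = (interval_perm s * interval_perm t)%g.
Proof. by apply: iet_ext => x; exact: E_funM. Qed.

Lemma interval_perm1 : interval_perm 1%g = 1%g.
Proof. by apply: iet_ext => x; exact: E_fun1. Qed.

Definition G1q : set iet := range interval_perm.

(* For Q included in G1q, the image of Q under the isomorphism G1q -> 'S_q, interval_perm s |-> s. *)
Definition symg (Q : groupClosed iet) : {set 'S_q} :=
  [set s | interval_perm s \in Q]%SET.

Fact symg_group_set Q : group_set (symg Q).
Proof.
apply/group_setP; split=> [|s t]; rewrite ?inE ?interval_perm1 ?gpred1//.
by rewrite interval_permM; exact: gpredM.
Qed.
Canonical symg_group Q := Group (symg_group_set Q).

Definition sigma : 'S_q := perm (@ordS_inj q).

End IntervalPerm.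

Definition Agrp s (alpha : 'I_s -> circle) :=
  subgroup (gen (range alpha : set (Algebra.to_multiplicative circle))).

Definition Hgrp s m (alpha : 'I_s -> circle) (g : 'I_m -> iet) :=
  subgroup (gen (range (rotation \o alpha) `|` range g)).

End Iet.

(* Main.v *)
Require Import Defs.
From HB Require Import structures.
From mathcomp Require Import all_boot all_order all_fingroup all_algebra all_solvable.
From mathcomp Require Import all_field all_character.
From mathcomp Require Import generic_quotient ring_quotient.
From mathcomp Require Import boolp classical_sets reals.
From mathcomp Require Import ring lra.

(** Write H for the group generated by the rotations and Q, and S for the
    image of Q in the symmetric group.  A surjection of H onto F * A with kernel
    [H, H] restricts to a morphism rho : S -> F, and everything follows once rho
    is known to be onto with kernel inside [W, W] ([torsion_quotient]): F is
    then S / ker rho with [S, S] <= ker rho <= [W, W] :&: S.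

    Onto.  The image of Q in F * A is finite and A is torsion free, so Q lands
    in F.  Hence A is generated by the s images beta_i of the rotations; as A is
    free of rank s, the beta_i are a basis ([int_free_span]).  An element of F
    is the image of some product of rotations and of an element of Q, and the
    independence of the beta_i forces all exponents of the rotations to vanish.

    Kernel.  It suffices to extend every linear character chi of W from S to a
    morphism on H, for this morphism is trivial on [H, H], while [W, W] is the
    common kernel of the linear characters.  Rescale [0, 1) to [0, q) and write
    a point as y + j with 0 <= y < 1 and j an integer.  Every f in H acts by
    (y, j) |-> (y + a mod 1, p_y j) for a fixed a and permutations p_y in W:
    a rotation by a / q has p_y = sigma ^ floor (y + a), and elements of Q have
    a constant p_y.  So, with omega = chi sigma, chi p_y has the form
      w * omega ^ (\sum_k n_k * floor (y + b_k)),   \sum_k n_k = 0,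
    where the b_k lie in the group L generated by 1 and the q * alpha_i.  The
    mean of floor (y + b) - floor y over a period is b, so
    w * omega ^ (\sum_k n_k * b_k) would be an invariant average, were the
    exponent an integer.  As L is free on 1 and the q * alpha_i, there is an
    additive psi : L -> Z with psi 1 = 1, and w * omega ^ (\sum_k n_k * psi b_k)
    is the wanted value ([has_weight]).  It multiplies under composition because
    translating all the b_k changes nothing when the n_k sum to zero.  On an
    element of Q given by t it must be chi t: this is [psi_sum_const], which
    says that a periodic step function with constant values modulo the order of
    omega has that same constant as its psi-average. *)

Set Implicit Arguments.
Unset Strict Implicit.
Unset Printing Implicit Defensive.

Import Order.TTheory GRing.Theory Num.Theory.

Local Open Scope ring_scope.

(** * Averages of periodic step functions *)

Section StepFunctions.
Variables (R : realType) (K : fieldType) (omega : K).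
Hypothesis omega_neq0 : omega != 0.
Variables (M : zmodType) (ev : {additive M -> R}) (psi : {additive M -> int}).
Variable (one : M).
Hypotheses (ev_inj : injective ev) (ev_one : ev one = 1) (psi_one : psi one = 1).

Implicit Types (l : seq (int * M)) (x y : R) (b : M).

Definition fpart (x : R) : R := x - (Num.floor x)%:~R.

Lemma fpart_ge0 x : 0 <= fpart x.
Proof. by rewrite subr_ge0 floor_le_tmp. Qed.

Lemma fpart_lt1 x : fpart x < 1.
Proof. by have := floorD1_gt x; rewrite intrD /fpart; lra. Qed.

Lemma floor_fpart x : x = (Num.floor x)%:~R + fpart x.
Proof. by rewrite addrC subrK. Qed.

Lemma floorDint x (n : int) : Num.floor (x + n%:~R) = Num.floor x + n.
Proof. by rewrite floorDrz ?intrKfloor ?intr_int. Qed.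

Lemma floor_uniq x (n : int) : n%:~R <= x -> x < n%:~R + 1 -> Num.floor x = n.
Proof. by move=> h1 h2; apply: floor_def; rewrite h1 intrD h2. Qed.

Definition floor_sum l y : int := \sum_(p <- l) p.1 * Num.floor (y + ev p.2).

Definition psi_sum l : int := \sum_(p <- l) p.1 * psi p.2.

Lemma floor_sub x t : 0 <= t -> t <= 1 ->
  Num.floor (- t + x) = Num.floor x - (if fpart x < t then 1 else 0).
Proof.
move=> t0 t1; have f0 := fpart_ge0 x; have f1 := fpart_lt1 x.
have e := floor_fpart x.
case: ltP => h; apply: floor_uniq; rewrite ?subr0 ?intrB; lra.
Qed.

(** A finite set of fractional parts leaves a gap to the right of [e], so that
    the points equal to [e] are those below [t] but not below [e]. *)
Lemma gap_after l (e : R) : e < 1 ->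
  exists t, [/\ e < t, t <= 1 &
   forall p, p \in l -> fpart (ev p.2) < t -> fpart (ev p.2) <= e].
Proof.
move=> e1; elim: l => [|p l [t [et t1 tP]]]; first by exists 1.
have [pe|ep] := leP (fpart (ev p.2)) e.
  exists t; split=> // p'; rewrite inE => /predU1P[->//|]; exact: tP.
exists (Num.min t (fpart (ev p.2))).
rewrite lt_min et ep ge_min t1; split=> // p'; rewrite inE lt_min.
by case/predU1P=> [->|/tP h] /andP[]; [rewrite ltxx | move=> /h].
Qed.

Lemma big_partition_seq (I J : eqType) (V : nmodType) (r : seq I) (f : I -> J)
    (F : I -> V) :
  \sum_(i <- r) F i =
  \sum_(j <- undup (map f r)) \sum_(i <- r | f i == j) F i.
Proof.
under [RHS]eq_bigr do rewrite big_mkcond; rewrite exchange_big /=.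
apply: eq_big_seq => i ir.
rewrite (bigD1_seq (f i)) ?undup_uniq ?mem_undup ?map_f//= eqxx.
by rewrite big1 ?addr0// => j; rewrite eq_sym => /negbTE ->.
Qed.

(** The jump of the step function at [y = - e] is the sum of the coefficients
    of the [b] with fractional part [e], so all these sums are killed by
    [omega].  By injectivity of [ev], [psi b - floor (ev b)] depends only on the
    fractional part of [ev b]; hence replacing [psi] by [floor \o ev] does not
    change the power of [omega], and what remains is the value at [0]. *)
Lemma psi_sum_const l z : (forall y, omega ^ floor_sum l y = z) ->
  omega ^ psi_sum l = z.
Proof.
move=> lz.
pose A t := \sum_(p <- l | fpart (ev p.2) < t) p.1.
have stepB t : 0 <= t -> t <= 1 -> floor_sum l (- t) = floor_sum l 0 - A t.
  move=> t0 t1; rewrite /A big_mkcond -sumrB; apply: eq_bigr => p _.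
  by rewrite floor_sub// add0r mulrBr; case: ltP => _; rewrite ?mulr1 ?mulr0.
have unitX n : omega ^ n != 0 by rewrite expfz_neq0.
have A1 t : 0 <= t -> t <= 1 -> omega ^ A t = 1.
  move=> t0 t1; have := lz (- t); rewrite stepB// expfzDr// lz => /eqP.
  rewrite -{2}[z]mulr1 (inj_eq (mulfI _)) -?(lz 0)//.
  by rewrite -invr_expz invr_eq1 => /eqP.
have class1 e : 0 <= e -> e < 1 ->
    omega ^ (\sum_(p <- l | fpart (ev p.2) == e) p.1) = 1.
  move=> e0 e1; have [t [et t1 tP]] := gap_after l e1.
  (* The fractional parts lying in [e, t) are all equal to e. *)
  have -> : \sum_(p <- l | fpart (ev p.2) == e) p.1 = A t - A e.
    rewrite /A [in X in X - _]big_mkcond [in X in _ - X]big_mkcond -sumrB.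
    rewrite [LHS]big_mkcond; apply: eq_big_seq => p pl.
    case: (ltgtP (fpart (ev p.2)) e) (tP p pl) => [fe|ef|->].
    - by rewrite (lt_trans fe et) subrr.
    - by case: ifP => _; rewrite ?subr0// => /(_ isT).
    - by rewrite et subr0.
  by rewrite expfzDr// -invr_expz !A1 ?invr1 ?mulr1//; lra.
pose th b := psi b - Num.floor (ev b).
have thE b b' : fpart (ev b) = fpart (ev b') -> th b = th b'.
  move=> bb'; suff [n ->] : exists n, b = b' + one *~ n.
    rewrite /th !raddfD /= !raddfMz ev_one psi_one floorDint intz.
    by rewrite opprD addrACA subrr addr0.
  exists (Num.floor (ev b) - Num.floor (ev b')); apply: ev_inj.
  by rewrite raddfD /= raddfMz ev_one intrB; move: bb'; rewrite /fpart; lra.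
(* The periodic part of psi is summed class by class of fractional parts. *)
have -> : psi_sum l = floor_sum l 0 + \sum_(p <- l) p.1 * th p.2.
  by rewrite -big_split; apply: eq_bigr => p _; rewrite /= add0r /th; ring.
rewrite expfzDr// lz -[RHS]mulr1; congr (_ * _).
rewrite (big_partition_seq _ (fun p => fpart (ev p.2))).
apply: (big_ind (fun n => omega ^ n = 1)) => // [m n hm hn|e _].
  by rewrite expfzDr// hm hn mulr1.
have [[p pl /eqP pe]|no] := altP (@hasP _ (fun p => fpart (ev p.2) == e) l); last first.
  by rewrite big_hasC.
rewrite (eq_bigr (fun p' => p'.1 * th p.2)) => [|p' /eqP p'e].
  rewrite -mulr_suml -exprz_exp class1 ?exp1rz// -pe ?fpart_ge0 ?fpart_lt1//.
by rewrite (thE p'.2 p.2) // p'e pe.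
Qed.

End StepFunctions.

(** * Extending linear characters along the action on cells *)

Section Weights.
Variables (R : realType) (q : nat).
Hypothesis q_gt0 : (0 < q)%N.
Variables (W : {group 'S_q}) (chi : 'CF(W)).
Hypotheses (sigmaW : sigma q \in W) (chi_lin : chi \is a linear_char).
Variables (M : zmodType) (ev : {additive M -> R}) (psi : {additive M -> int}).
Variable (one : M).
Hypotheses (ev_inj : injective ev) (ev_one : ev one = 1) (psi_one : psi one = 1).

Implicit Types (f g : iet R) (l : seq (int * M)) (x : unit_ico R) (y : R).

Notation omega := (chi (sigma q)).
Notation floor_sum := (floor_sum ev).
Notation psi_sum := (psi_sum psi).

Lemma omega_neq0 : omega != 0.
Proof. exact: lin_char_neq0. Qed.

Lemma q_gt0R : (0 : R) < q%:R.
Proof. by rewrite ltr0n. Qed.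

(** [x] has coordinates [(y, j)] once [0, 1) is stretched to [0, q). *)
Definition point_at x y (j : nat) := val x * q%:R = y + j%:R.

Lemma point_exists y (j : 'I_q) : 0 <= y -> y < 1 -> exists x, point_at x y j.
Proof.
move=> y0 y1; have q0 := q_gt0R.
have jq : j.+1%:R <= q%:R :> R by rewrite ler_nat.
have xP : (y + j%:R) / q%:R \in `[(0 : R), 1[.
  rewrite in_itv /= ltr_pdivrMr// mul1r divr_ge0 ?addr_ge0 ?ler0n//=.
  by rewrite (lt_le_trans _ jq)// -natr1 addrC ltrD2l.
by exists (UnitIco xP); rewrite /point_at /= divfK// gt_eqF.
Qed.

Lemma point_inj x x' y (j : nat) : point_at x y j -> point_at x' y j -> x = x'.
Proof.
rewrite /point_at => <- /esym h; apply: val_inj.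
by apply: (mulIf _ h); rewrite gt_eqF ?q_gt0R.
Qed.

Lemma point_cell x y (j : 'I_q) : 0 <= y -> y < 1 -> point_at x y j ->
  val x \in cell R j.
Proof.
move=> y0 y1 xP; rewrite in_itv /= ler_pdivrMr ?q_gt0R// ltr_pdivlMr ?q_gt0R//.
by rewrite xP -natr1; apply/andP; split; lra.
Qed.

Lemma point_coord y y' (i j : nat) : 0 <= y -> y < 1 -> 0 <= y' -> y' < 1 ->
  y + i%:R = y' + j%:R -> i = j.
Proof.
move=> y0 y1 y'0 y'1 e; apply/eqP; rewrite eqn_leq; apply/andP; split.
  by rewrite -ltnS -(ltr_nat R) -natr1; lra.
by rewrite -ltnS -(ltr_nat R) -natr1; lra.
Qed.

Definition acts_over f y y' (p : 'S_q) :=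
  forall (j : 'I_q) x, point_at x y j -> point_at (f x) y' (p j).

(** [v] is the psi-average over a period of [chi] of the permutation by which
    [f] acts above [y]; the vanishing of the sum of the coefficients makes
    [floor_sum l] periodic. *)
Definition has_weight f (v : algC) :=
  exists (a : M) (w : algC) (l : seq (int * M)),
    [/\ w != 0, \sum_(n <- l) n.1 = 0, v = w * omega ^ psi_sum l &
     forall y, 0 <= y -> y < 1 -> exists p,
       [/\ p \in W, chi p = w * omega ^ floor_sum l y &
        acts_over f y (fpart (y + ev a)) p]].

Definition translate (l : seq (int * M)) (a : M) :=
  [seq (n.1, n.2 + a) | n <- l].

Lemma sum_translate l a : \sum_(n <- translate l a) n.1 = \sum_(n <- l) n.1.
Proof. by rewrite big_map. Qed.

Lemma psi_sum_translate l a :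
  \sum_(n <- l) n.1 = 0 -> psi_sum (translate l a) = psi_sum l.
Proof.
move=> l0; rewrite /psi_sum big_map /=.
under eq_bigr do rewrite raddfD mulrDr.
by rewrite big_split /= -mulr_suml l0 mul0r addr0.
Qed.

Lemma floor_sum_translate l a y :
  \sum_(n <- l) n.1 = 0 ->
  floor_sum (translate l a) y = floor_sum l (fpart (y + ev a)).
Proof.
move=> l0; rewrite /floor_sum big_map /=.
under eq_bigr => n _.
  rewrite raddfD (_ : y + _ = fpart (y + ev a) + ev n.2
    + (Num.floor (y + ev a))%:~R); last by rewrite /fpart; ring.
  rewrite floorDint mulrDr; over.
by rewrite big_split /= -mulr_suml l0 mul0r addr0.
Qed.

Lemma floor_sum_periodic l y :
  \sum_(n <- l) n.1 = 0 -> floor_sum l y = floor_sum l (fpart y).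
Proof.
move=> l0; rewrite -[in RHS](addr0 y) -(raddf0 ev) -floor_sum_translate//.
by rewrite /floor_sum big_map; apply: eq_bigr => n _; rewrite addr0.
Qed.

Lemma fpartD y z : fpart (fpart y + z) = fpart (y + z).
Proof.
have -> : fpart y + z = y + z + (- Num.floor y)%:~R.
  by rewrite /fpart mulrNz; ring.
by rewrite {1}/fpart floorDint intrD /fpart; ring.
Qed.

Lemma fpart_id y : 0 <= y -> y < 1 -> fpart y = y.
Proof. by move=> y0 y1; rewrite /fpart (@floor_uniq _ _ 0) ?add0r ?subr0. Qed.

Lemma has_weight_neq0 f v : has_weight f v -> v != 0.
Proof.
by move=> [a [w [l [w0 _ -> _]]]]; rewrite mulf_neq0// expfz_neq0// omega_neq0.
Qed.

(** The permutations above [y] compose as a cocycle: that of [g] is taken above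
    the point to which [f] moves [y], which is a translation of the step
    function of [g] and leaves its average unchanged. *)
Lemma has_weightM f g u v :
  has_weight f u -> has_weight g v -> has_weight (f * g)%g (u * v).
Proof.
move=> [a [w [l [w0 l0 -> fP]]]] [a' [w' [l' [w'0 l'0 -> gP]]]].
have o0 := omega_neq0.
exists (a + a'), (w * w'), (l ++ translate l' a); split.
- by rewrite mulf_neq0.
- by rewrite big_cat /= sum_translate l0 l'0 addr0.
- rewrite mulrACA -expfzDr// -(psi_sum_translate a l'0).
  by rewrite /psi_sum big_cat.
move=> y y0 y1; have [p [pW pE pP]] := fP y y0 y1.
have [p' [p'W p'E p'P]] := gP _ (fpart_ge0 (y + ev a)) (fpart_lt1 _).
exists (p * p')%g; split; first exact: groupM.
- rewrite lin_charM// pE p'E [floor_sum (l ++ _) y]big_cat /=.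
  rewrite -/(floor_sum l y) -/(floor_sum _ y) floor_sum_translate// expfzDr//; ring.
- move=> j x /pP /p'P; rewrite permM.
  by rewrite fpartD -addrA -raddfD.
Qed.

Lemma has_weightV f v : has_weight f v -> has_weight f^-1%g v^-1.
Proof.
move=> [a [w [l [w0 l0 -> fP]]]]; have o0 := omega_neq0.
pose l' := [seq (- n.1, n.2) | n <- l].
have l'0 : \sum_(n <- l') n.1 = 0 by rewrite big_map sumrN l0 oppr0.
exists (- a), w^-1, (translate l' (- a)); split.
- by rewrite invr_eq0.
- by rewrite sum_translate.
- rewrite psi_sum_translate// invfM invr_expz; congr (_ * _ ^ _).
  by rewrite /psi_sum big_map -sumrN; apply: eq_bigr => n _; rewrite mulNr.
move=> y y0 y1; have [p [pW pE pP]] := fP _ (fpart_ge0 (y - ev a)) (fpart_lt1 _).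
exists p^-1%g; rewrite groupV; split=> //.
- rewrite lin_charV// pE invfM invr_expz floor_sum_translate// raddfN.
  congr (_ * _ ^ _).
  by rewrite /floor_sum big_map -sumrN; apply: eq_bigr => n _; rewrite mulNr.
- move=> j x xj; rewrite raddfN.
  have [z zP] := point_exists (p^-1%g j) (fpart_ge0 (y - ev a)) (fpart_lt1 _).
  suff -> : (f^-1)%g x = z by [].
  apply: (can_inj (_ : cancel f f^-1%g)) => [t|].
    exact: (congr1 (fun h : iet R => h t) (mulgV f)).
  have -> : f ((f^-1)%g x) = x by exact: (congr1 (fun h : iet R => h x) (mulVg f)).
  have := pP _ _ zP; rewrite permKV fpartD subrK fpart_id//.
  exact: point_inj.
Qed.

Lemma acts_over_interval_perm y (t : 'S_q) : 0 <= y -> y < 1 ->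
  acts_over (interval_perm R t) y y t.
Proof.
move=> y0 y1 j x xj; rewrite /point_at /= (E_valE _ (point_cell y0 y1 xj)).
by rewrite /shift mulrDl xj divfK ?gt_eqF ?q_gt0R//; ring.
Qed.

Lemma has_weight_perm (t : 'S_q) :
  t \in W -> has_weight (interval_perm R t) (chi t).
Proof.
move=> tW; exists 0, (chi t), [::]; rewrite big_nil /psi_sum big_nil mulr1.
split=> //; first exact: lin_char_neq0.
move=> y y0 y1; exists t; rewrite /floor_sum big_nil mulr1; split=> //.
by rewrite raddf0 addr0 fpart_id//; exact: acts_over_interval_perm.
Qed.

(** The weights of [f] may depend on how the action of [f] is described; for
    [f] an interval permutation the step function is constant, and
    [psi_sum_const] leaves a single value. *)
Lemma has_weight_perm_inv (t : 'S_q) v :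
  has_weight (interval_perm R t) v -> v = chi t.
Proof.
move=> [a [w [l [w0 l0 -> fP]]]].
suff h y : omega ^ floor_sum l y = w^-1 * chi t.
  by rewrite (psi_sum_const omega_neq0 ev_inj ev_one psi_one h) mulVKf.
rewrite floor_sum_periodic//; have y0 := fpart_ge0 y; have y1 := fpart_lt1 y.
have [p [pW pE pP]] := fP _ y0 y1.
suff -> : t = p by rewrite pE mulKf.
apply/permP => j; apply: ord_inj.
have [x xj] := point_exists j y0 y1.
have := acts_over_interval_perm t y0 y1 xj; have := pP _ _ xj.
rewrite /point_at => -> /esym; apply: point_coord => //; [exact: fpart_ge0|exact: fpart_lt1].
Qed.

Lemma sigmaX (k : nat) (j : 'I_q) : ((sigma q ^+ k)%g j = (j + k) %% q :> nat)%N.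
Proof.
elim: k => [|k IH]; first by rewrite expg0 perm1 addn0 modn_small.
by rewrite expgSr permM permE /= IH -addn1 modnDml addn1 addnS.
Qed.

Lemma sigma_q : (sigma q ^+ q = 1)%g.
Proof.
by apply/permP => j; apply: ord_inj; rewrite sigmaX perm1 modnDr modn_small.
Qed.

(** A rotation carries [y + j] to [y + a + j] modulo [q], so above [y] it acts
    as [sigma] to the power [floor (y + a)], which is
    [floor (y + a) - floor y]. *)
Lemma has_weight_rotation (c : circle R) (a : M) : ev a = repr c * q%:R ->
  has_weight (rotation c) (omega ^ psi a).
Proof.
move=> aE; have o0 := omega_neq0; have q0 := q_gt0R.
(* The second term stands for - floor y and makes the coefficients sum to 0. *)
exists a, 1, [:: (1, a); (-1, 0)]; rewrite oner_neq0; split=> //.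
- by rewrite !big_cons big_nil.
- by rewrite /psi_sum !big_cons big_nil /= raddf0 mul1r mulr0 !addr0 mul1r.
move=> y y0 y1; pose N := Num.floor (y + ev a).
have N_ge0 : 0 <= (N %% q)%Z by rewrite modz_ge0// -lt0n.
case kE : (N %% q)%Z N_ge0 => [k|//] _.
exists (sigma q ^+ k)%g; split; first exact: groupX.
- have oq : omega ^ (q : int) = 1.
    by rewrite -exprnP -lin_charX// sigma_q lin_char1.
  rewrite /floor_sum !big_cons big_nil /= raddf0 !addr0 mul1r mulN1r.
  rewrite (@floor_uniq _ y 0) ?add0r// oppr0 addr0 mul1r -/N lin_charX//.
  rewrite (divz_eq N q) kE expfzDr// mulrC -exprz_exp.
  by rewrite mulrC exprzAC oq exp1rz mul1r.
move=> j x xj.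
have [x' x'j] := point_exists ((sigma q ^+ k)%g j) (fpart_ge0 (y + ev a)) (fpart_lt1 _).
suff -> : rotation c x = x' by [].
(* e counts the turns made around the stretched circle of length q. *)
have [e eE] : exists e : int, N + j = e * q + ((sigma q ^+ k)%g j)%:Z.
  exists ((N %/ q)%Z + ((j + k) %/ q)%N).
  rewrite sigmaX {1}(divz_eq N q) kE mulrDl -!addrA; congr (_ + _).
  by rewrite -PoszM -!PoszD -divn_eq addnC.
apply: (@frac_eq _ _ _ e).
have eER : (N%:~R + j%:R : R) = e%:~R * q%:R + ((sigma q ^+ k)%g j)%:R.
  by have := congr1 (fun z : int => z%:~R : R) eE; rewrite !intrD intrM.
apply: (@mulIf _ q%:R); first by rewrite gt_eqF.
rewrite !mulrDl xj -aE x'j -/N /fpart -/N; lra.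
Qed.

End Weights.

(** * Free families and generated subgroups *)

Section Lattices.
Variables (C : zmodType) (s : nat) (alpha : 'I_s -> C).

Definition int_span (b : 'I_s -> C) (x : C) := exists n : 'I_s -> int,
  x = \sum_i b i *~ n i.

Definition int_free (b : 'I_s -> C) := forall n : 'I_s -> int,
  \sum_i b i *~ n i = 0 -> forall i, n i = 0.

Lemma int_free_torsion (x : C) (N : nat) :
  int_free alpha -> int_span alpha x -> (0 < N)%N -> x *+ N = 0 -> x = 0.
Proof.
move=> fr [n ->] N0 /eqP; rewrite -sumrMnl.
under eq_bigr do rewrite pmulrn -mulrzA.
move=> /eqP /fr h; apply: big1 => i _.
have /eqP := h i; rewrite mulf_eq0 => /orP[/eqP ->|]; first by rewrite mulr0z.
by rewrite eqz_nat gtn_eqF.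
Qed.

(** The two change-of-basis matrices are square and one product is the identity,
    hence so is the other. *)
Lemma int_free_span (beta : 'I_s -> C) : int_free alpha ->
  (forall i, int_span alpha (beta i)) -> (forall i, int_span beta (alpha i)) ->
  int_free beta.
Proof.
move=> fr /boolp.choice[b bE] /boolp.choice[c cE].
pose B := (\matrix_(i, j) b i j)%R; pose D := (\matrix_(i, j) c i j)%R.
have comb (n : 'rV[int]_s) :
    \sum_i beta i *~ n 0 i = \sum_j alpha j *~ (n *m B) 0 j.
  under eq_bigr => i _ do rewrite bE mulrz_suml.
  rewrite exchange_big; apply: eq_bigr => j _; rewrite mxE mulrz_sumr.
  by apply: eq_bigr => i _; rewrite -mulrzA !mxE mulrC.
(* The rows of D *m B are the coordinates of the alpha i in themselves. *)
have DB : D *m B = 1%:M.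
  apply/row_matrixP => i; apply/rowP => j; apply/eqP; rewrite -subr_eq0; apply/eqP.
  move: j; apply: fr; rewrite -[RHS](subrr (alpha i)).
  under eq_bigr do rewrite mulrzBr; rewrite sumrB; congr (_ - _).
    rewrite row_mul -comb [RHS]cE; apply: eq_bigr => k _; by rewrite !mxE.
  rewrite (bigD1 i)//= big1 => [|k ki]; first by rewrite !mxE eqxx addr0.
  by rewrite !mxE eq_sym (negbTE ki).
move=> n n0 i.
have nB : (\row_i n i) *m B = 0.
  apply/rowP => j; rewrite [RHS]mxE; move: j; apply: fr.
  by rewrite -comb -[RHS]n0; apply: eq_bigr => k _; rewrite mxE.
have /rowP/(_ i) : (\row_i n i) = 0 :> 'rV[int]_s.
  by rewrite -[LHS]mulmx1 -(mulmx1C DB) mulmxA nB mul0mx.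
by rewrite !mxE.
Qed.

End Lattices.

Section Generated.
Local Open Scope group_scope.
Variables (G : groupType) (X : set G).

Lemma gen_ind (P : subgroup (gen X) -> Prop) :
  P 1 -> (forall x y, P x -> P y -> P (x * y^-1)) ->
  (forall x, X (val x) -> P x) -> forall x, P x.
Proof.
move=> P1 PF PX [x xX].
pose K : {pred G} := fun z => `[< exists2 u : subgroup (gen X), val u = z & P u >].
have gK : group_closed K.
  split=> [|y z /asboolP[u <- Pu] /asboolP[v <- Pv]]; apply/asboolP.
    by exists 1.
  by exists (u * v^-1) => //; exact: PF.
have /asboolP[u uE Pu] : x \in K.
  apply: (gen_min gK _ xX) => y Xy; apply/asboolP.
  by exists (Subgroup (Defs.sub_gen Xy)) => //; exact: PX.
suff -> : Subgroup xX = u by [].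
exact: val_inj.
Qed.

End Generated.

(** * The kernel of the map from permutations to the abelianization *)

Definition to_circle (R : realType) (x : R) : circle R := \pi_(circle R)%qT x.

Fact to_circle_is_zmod_morphism (R : realType) : zmod_morphism (@to_circle R).
Proof.
move=> x y; transitivity (to_circle x + to_circle (- y)).
  exact: Quotient.pi_add.
by congr (_ + _); exact: Quotient.pi_opp.
Qed.
HB.instance Definition _ (R : realType) := GRing.isZmodMorphism.Build
  R (circle R) (@to_circle R) (@to_circle_is_zmod_morphism R).

Lemma to_circle_int (R : realType) (j : int) : to_circle (j%:~R : R) = 0.
Proof.
rewrite -(raddf0 (@to_circle R)); apply/eqP; rewrite /to_circle.
by rewrite -Quotient.idealrBE subr0; exact: intr_int.
Qed.

Lemma to_circle_repr (R : realType) (c : circle R) : to_circle (repr c) = c.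
Proof. exact: reprK. Qed.

Section Evaluation.
Variables (R : realType) (q s : nat) (alpha : 'I_s -> circle R).
Hypotheses (q_gt0 : (0 < q)%N) (alpha_free : int_free alpha).

(** Coordinates on the subgroup L of the reals generated by 1 and the
    representatives of the [alpha i] scaled by [q]; in coordinates psi is the
    first projection. *)
Definition lattice := (int * {ffun 'I_s -> int})%type.
HB.instance Definition _ := GRing.Zmodule.on lattice.

Definition lattice_ev (b : lattice) : R :=
  b.1%:~R + \sum_i (repr (alpha i) * q%:R) *~ b.2 i.

Fact lattice_ev_is_zmod_morphism : zmod_morphism lattice_ev.
Proof.
move=> b b'; rewrite /lattice_ev /= intrB.
under eq_bigr do rewrite !ffunE mulrzBr.
by rewrite sumrB opprD addrACA.
Qed.
HB.instance Definition _ :=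
  GRing.isZmodMorphism.Build lattice R lattice_ev lattice_ev_is_zmod_morphism.

Definition lattice_fst (b : lattice) : int := b.1.
HB.instance Definition _ :=
  GRing.isZmodMorphism.Build lattice int lattice_fst (fun _ _ => erefl).

Definition lattice_one : lattice := (1, 0).

Lemma lattice_ev_one : lattice_ev lattice_one = 1.
Proof.
by rewrite /lattice_ev big1 ?addr0// => i _; rewrite ffunE.
Qed.

(** This is where the rational independence of 1 and the [alpha i] is used. *)
Lemma lattice_ev_inj : injective lattice_ev.
Proof.
apply: raddf_inj => -[k n] /= /[dup] evz.
move=> /(congr1 (@to_circle R)); rewrite raddfD /= to_circle_int add0r raddf0 raddf_sum /=.
under eq_bigr do rewrite raddfMz mulr_natr raddfMn /= to_circle_repr pmulrn -mulrzA.
move=> /alpha_free n0.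
have {}n0 : n = 0.
  apply/ffunP => i; rewrite ffunE; have /eqP := n0 i.
  by rewrite mulf_eq0 eqz_nat gtn_eqF//= => /eqP.
move: evz; rewrite n0 /lattice_ev /= big1 => [|i _]; last by rewrite ffunE.
by rewrite addr0 => /eqP; rewrite intr_eq0 => /eqP ->.
Qed.

Definition lattice_gen (i : 'I_s) : lattice := (0, [ffun j => (j == i)%:Z]).

Lemma lattice_ev_gen i : lattice_ev (lattice_gen i) = repr (alpha i) * q%:R.
Proof.
rewrite /lattice_ev add0r (bigD1 i)//= big1 => [|j ji]; rewrite ffunE.
  by rewrite eqxx addr0.
by rewrite (negbTE ji).
Qed.

End Evaluation.

Section Kernel.
Local Open Scope group_scope.
Variables (R : realType) (s m q : nat).
Hypothesis q_gt0 : (0 < q)%N.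
Variables (alpha : 'I_s -> circle R) (g : 'I_m -> iet R).
Hypotheses (alpha_free : int_free alpha) (g_in : forall j, G1q q (g j)).

Let Q : groupClosed (iet R) := gen (range g)%classic.
Let SQ : {group 'S_q} := symg_group q Q.

Lemma Q_interval_perm x : x \in gen (range g) ->
  exists2 t : 'S_q, t \in SQ & x = interval_perm R t.
Proof.
move=> xQ; suff [t xE] : exists t : 'S_q, x = interval_perm R t.
  by exists t => //; rewrite inE -xE.
pose K : {pred iet R} := fun z => `[< exists t : 'S_q, z = interval_perm R t >].
apply/asboolP; apply: (gen_min (K := K)) xQ => [|_ [j _ <-]].
  split=> [|_ _ /asboolP[t ->] /asboolP[u ->]]; apply/asboolP.
    by exists 1; rewrite interval_perm1.
  exists (t * u^-1); apply: (mulIg (interval_perm R u)).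
  by rewrite mulgVK -interval_permM mulgVK.
by apply/asboolP; have [t _ <-] := g_in j; exists t.
Qed.

(** [[~: W, W]] is the common kernel of the linear characters of [W].  Every
    element of the group has a weight for each such character, so commutators,
    and with them the derived subgroup, have weight 1, while the weight of the
    interval permutation of [t] is the value of the character at [t]. *)
Lemma der_interval_perm (W : {group 'S_q}) (h : Hgrp alpha g) (t : 'S_q) :
  SQ \subset W -> sigma q \in W -> t \in W ->
  val h = interval_perm R t -> h \in der (Hgrp alpha g) -> t \in [~: W, W].
Proof.
move=> /fintype.subsetP SQW sW tW hE hder.
rewrite -[[~: W, W]]cap_cfker_lin_irr; apply/bigcapP => i chi_lin.
have ev_inj := lattice_ev_inj q_gt0 alpha_free.
have ev_one := lattice_ev_one q alpha.
have psi_one : lattice_fst (lattice_one s) = 1%R by [].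
pose weight := has_weight 'chi_i (lattice_ev q alpha) (@lattice_fst s).
have wM := has_weightM sW chi_lin.
have wV := has_weightV q_gt0 sW chi_lin.
have w1 : weight 1 1%R.
  by rewrite -(interval_perm1 R q) -(lin_char1 chi_lin); apply: has_weight_perm.
have weighted (x : Hgrp alpha g) : exists v, weight (val x) v.
  elim/gen_ind: x => [|x y [u xu] [v yv]|x [[j _ /= <-]|[j _ xE]]].
  - by exists 1%R.
  - by exists (u * v^-1)%R; apply: (wM) => //; apply: (wV).
  - eexists; apply: has_weight_rotation => //; exact: lattice_ev_gen.
  - have [u uSQ uE] := Q_interval_perm (Defs.sub_gen (imageT g j)).
    by exists ('chi_i u); rewrite -xE uE; apply: has_weight_perm => //; exact: SQW.
have : weight (val h) 1%R.
  pose K : {pred Hgrp alpha g} := fun x => `[< weight (val x) 1%R >].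
  apply/asboolP; apply: (gen_min (K := K)) hder.
    split=> [|x y /asboolP xw /asboolP yw]; apply/asboolP => //.
    by rewrite -(mulr1 1%R) -[X in (_ * X)%R]invr1; apply: (wM) => //; apply: (wV).
  move=> _ [x _ [y _ <-]]; apply/asboolP.
  have [[u xu] [v yv]] := (weighted x, weighted y).
  have u0 := has_weight_neq0 sW chi_lin xu; have v0 := has_weight_neq0 sW chi_lin yv.
  have -> : 1%R = (u^-1 * (v^-1 * (u * v)))%R :> algC.
    by rewrite (mulrC u) mulKf ?mulVf.
  by apply: (wM) => /=; [apply: (wV) | apply: (wM); [apply: (wV) | apply: (wM)]].
rewrite hE => /(has_weight_perm_inv q_gt0 sW chi_lin ev_inj ev_one psi_one) h1.
by rewrite cfkerEchar ?lin_charW// inE tW -h1 lin_char1// eqxx.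
Qed.

End Kernel.

(** * The torsion of the abelianization *)

Section AdditiveGroup.
Local Open Scope group_scope.
Variable F : finGroupType.

(** An additive copy of [F], so that the target [F * A] of the abelianization
    lives in a Z-module. *)
Definition additive_group of abelian [set: F] : Type := F.

Variable F_abelian : abelian [set: F].
Notation V := (additive_group F_abelian).
HB.instance Definition _ := Choice.copy V F.

Fact additive_groupC : @commutative V F (@mulg F).
Proof. by move=> x y; apply: (centsP F_abelian); rewrite inE. Qed.

HB.instance Definition _ := GRing.isZmodule.Build V
  (@mulgA F) additive_groupC (@mul1g F) (@mulVg F).

End AdditiveGroup.

Section TorsionQuotient.
Local Open Scope group_scope.
Variables (R : realType) (s m q : nat).
Hypothesis q_gt0 : (0 < q)%N.
Variables (alpha : 'I_s -> circle R) (g : 'I_m -> iet R).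
Hypotheses (alpha_free : int_free alpha) (g_in : forall j, G1q q (g j)).
Variables (F : finGroupType) (F_abelian : abelian [set: F]).
Hypothesis F_def :
  isomorphic (abelianization (Hgrp alpha g)) (F * Agrp alpha)%type.

Notation H := (Hgrp alpha g).
Let Q : groupClosed (iet R) := gen (range g)%classic.
Let SQ : {group 'S_q} := symg_group q Q.
Let W : {group 'S_q} := (SQ <*> <[sigma q]>)%G.

Lemma Agrp_span (a : Agrp alpha) : int_span alpha (val a : circle R).
Proof.
elim/gen_ind: a => [|x y [n xn] [k yk]|x [i _ xi]].
- by exists (fun=> 0%R); rewrite big1.
- exists (fun i => n i - k i)%R; rewrite [LHS](_ : _ = (val x : circle R) - val y)%R //.
  by rewrite xn yk -sumrB; apply: eq_bigr => i _; rewrite mulrzBr.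
- exists (fun j => (j == i)%:Z); rewrite -xi (bigD1 i)//= big1 ?eqxx ?addr0//.
  by move=> j /negbTE ->.
Qed.

Fact rotation_in i :
  rotation (alpha i) \in
  gen (range (rotation (R:=R) \o alpha) `|` range g)%classic.
Proof. by apply: Defs.sub_gen; left; exists i. Qed.

Definition rotation_H i : H := Subgroup (rotation_in i).

Lemma Q_sub_H x : x \in gen (range g) ->
  x \in gen (range (rotation (R:=R) \o alpha) `|` range g)%classic.
Proof.
apply: gen_min; first exact: gen_group_closed.
by move=> y gy; apply: Defs.sub_gen; right.
Qed.

(** The default value 1 can only occur outside [SQ]. *)
Definition perm_H (t : 'S_q) : H := insubd 1 (interval_perm R t).

Lemma val_perm_H t : t \in SQ -> val (perm_H t) = interval_perm R t.
Proof. by rewrite inE => tQ; rewrite insubdK//; exact: Q_sub_H. Qed.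

Lemma perm_HM : {in SQ &, {morph perm_H : t u / t * u}}.
Proof.
move=> t u tQ uQ; apply: val_inj.
by rewrite /= !val_perm_H ?groupM// interval_permM.
Qed.

(** In an abelian target the rotations can be gathered, and what is left comes
    from a single element of [Q]. *)
Lemma image_decomp (V : zmodType) (Psi : H -> V) :
  (forall x y, Psi (x * y) = (Psi x + Psi y)%R) ->
  forall x, exists n : 'I_s -> int, exists2 t, t \in SQ &
    Psi x = (\sum_i Psi (rotation_H i) *~ n i + Psi (perm_H t))%R.
Proof.
move=> PsiM.
have Psi1 : Psi 1 = 0%R by apply: (addrI (Psi 1)); rewrite -PsiM mulg1 addr0.
have PsiF x y : Psi (x * y^-1) = (Psi x - Psi y)%R.
  by apply: (addIr (Psi y)); rewrite -PsiM mulgVK subrK.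
have perm_H1 : perm_H 1 = 1 by apply: val_inj; rewrite val_perm_H ?group1// interval_perm1.
have perm_HV t : t \in SQ -> Psi (perm_H t^-1) = (- Psi (perm_H t))%R.
  move=> tQ; apply: (addIr (Psi (perm_H t))).
  by rewrite -PsiM -perm_HM ?groupV// mulVg addNr perm_H1.
elim/gen_ind => [|x y [n [t tQ xE]] [k [u uQ yE]]|x [[i _ /= xE]|[j _ xE]]].
- exists (fun=> 0%R), 1; rewrite ?group1// big1 => [|i _]; last by rewrite mulr0z.
  by rewrite perm_H1 add0r.
- exists (fun i => n i - k i)%R, (t * u^-1); first by rewrite groupM ?groupV.
  rewrite PsiF xE yE perm_HM ?groupV// PsiM perm_HV// opprD addrACA -sumrB.
  by under eq_bigr do rewrite -mulrzBr.
- exists (fun j => (j == i)%:Z), 1; rewrite ?group1//.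
  rewrite perm_H1 Psi1 addr0 (bigD1 i)//= big1 => [|j /negbTE ->]; last by rewrite mulr0z.
  by rewrite eqxx addr0; congr Psi; apply: val_inj; exact: esym.
- have [t tQ tE] := Q_interval_perm g_in (Defs.sub_gen (imageT g j)).
  exists (fun=> 0%R), t => //; rewrite big1 => [|i _]; last by rewrite mulr0z.
  by rewrite add0r; congr Psi; apply: val_inj; rewrite val_perm_H// -tE; exact: esym.
Qed.

(** The morphism is the restriction to [SQ] of the first component of
    the given map to [F * A]. *)
Theorem torsion_quotient : exists rho : {morphism SQ >-> F},
  rho @* SQ = [set: F] /\ 'ker rho \subset [~: W, W].
Proof.
have [f f_bij] := F_def.
pose phi (h : H) := f (\pi_(abelianization H)%qT h).
have phiM x y : phi (x * y) = phi x * phi y.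
  by rewrite /phi -gmulfM -ab_mulE.
have [f' fK f'K] := f_bij.
have phi_onto z : exists h, phi h = z.
  by exists (repr (f' z)); rewrite /phi reprK f'K.
have phi_der h : phi h = 1 -> h \in der H.
  have f1 : f 1 = 1 by apply: (mulgI (f 1)); rewrite -gmulfM !mulg1.
  rewrite /phi -f1 => /(bij_inj f_bij) /esym /pi_abE.
  by rewrite /ab_rel invg1 mul1g.
pose V := (additive_group F_abelian * circle R)%type.
pose Psi (h : H) : V := ((phi h).1, val (phi h).2).
have PsiM x y : Psi (x * y) = (Psi x + Psi y)%R by rewrite /Psi phiM.
have decomp := image_decomp PsiM.
pose beta i : circle R := val (phi (rotation_H i)).2.
have Psi_perm t : t \in SQ -> val (phi (perm_H t)).2 = 0%R :> circle R.
  move=> tQ; pose T u : circle R := val (phi (perm_H u)).2.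
  have TM u v : u \in SQ -> v \in SQ -> T (u * v) = (T u + T v)%R.
    by move=> uQ vQ; rewrite /T perm_HM// phiM.
  have T1 : T 1 = 0%R by apply: (addrI (T 1)); rewrite -TM ?group1// mulg1 addr0.
  (* t has finite order, so its A-component is torsion. *)
  apply: (int_free_torsion alpha_free (Agrp_span _) (order_gt0 t)).
  rewrite -T1 -(expg_order t); elim: #[t] => [|k IH]; first by rewrite mulr0n -T1.
  by rewrite mulrS IH expgS TM ?groupX.
(* The beta i span A because the rotations generate it modulo torsion. *)
have beta_free : int_free beta.
  apply: (int_free_span alpha_free) => i; first exact: Agrp_span.
  have alphaA : alpha i \in gen (range alpha : set (Algebra.to_multiplicative (circle R))).
    by apply: Defs.sub_gen; exists i.
  have [h hE] := phi_onto (1, Subgroup alphaA).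
  have [n [t tQ /(congr1 snd)]] := decomp h.
  rewrite /Psi hE /= Psi_perm// addr0 => aE; exists n; rewrite [LHS]aE.
  by rewrite raddf_sum; apply: eq_bigr => j _; rewrite raddfMz.
have rhoM : {in SQ &, {morph (fun t => (phi (perm_H t)).1) : t u / t * u}}.
  by move=> t u tQ uQ; rewrite perm_HM// phiM.
exists (Morphism rhoM); split.
  apply/setP => x; rewrite inE; apply/morphimP.
  (* A preimage of (x, 1): its exponents on the rotations must vanish. *)
  have [h hE] := phi_onto (x, 1).
  have [n [t tQ hn]] := decomp h.
  have n0 i : n i = 0%R.
    move: i; apply: beta_free; move/(congr1 snd): hn.
    rewrite /Psi hE /= Psi_perm// addr0 => /esym.
    rewrite raddf_sum [RHS](_ : _ = 0%R)// => e; rewrite -[RHS]e.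
    by apply: eq_bigr => j _; rewrite raddfMz.
  exists t => //; move/(congr1 fst): hn; rewrite /Psi hE big1 => [/= ->|i _].
    by rewrite add0r.
  by rewrite n0 mulr0z.
apply/fintype.subsetP => t /morphpreP[tQ]; rewrite inE => /eqP /= t1.
apply: (@der_interval_perm R s m q q_gt0 alpha g alpha_free g_in W (perm_H t)).
- exact: joing_subl.
- by apply: (fintype.subsetP (joing_subr _ _)); exact: cycle_id.
- by apply: (fintype.subsetP (joing_subl _ _)).
- exact: val_perm_H.
apply: phi_der; rewrite [LHS]surjective_pairing t1.
by congr (_, _); apply: val_inj; exact: Psi_perm.
Qed.

End TorsionQuotient.

(** * Alternating groups and the conclusion *)

Lemma der_even (T : finType) (W : {group {perm T}}) :
  ([~: W, W] \subset 'Alt_T)%g.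
Proof.
rewrite gen_subG; apply/fintype.subsetP => _ /imset2P[x y _ _ ->].
by rewrite Alt_even odd_permM odd_permV odd_permJ addbb.
Qed.

Lemma Alt_perfect (T : finType) :
  (4 < #|T|)%N -> ('Alt_T = [~: 'Alt_T, 'Alt_T])%g.
Proof.
move=> T5; have /simpleP[_ Alt_min] := simple_Alt5 T5.
have [der1|//] := Alt_min [group of [~: 'Alt_T, 'Alt_T]]%g (der_normal 1 _).
have := solvable_AltF T5; rewrite abelian_sol//.
by apply/derG1P.
Qed.

Local Open Scope quotient_scope.
Local Open Scope group_scope.

Theorem corollary1 (R : realType) (s m q : nat)
    (s_gt0 : (0 < s)%N) (m_gt0 : (0 < m)%N) (q_gt0 : (0 < q)%N)
    (alpha : 'I_s -> circle R)
    (alpha_irr : forall (i : 'I_s) (r : rat), alpha i <> \pi_(circle R) (ratr r))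
    (alpha_free : forall n : 'I_s -> int,
        (\sum_(i < s) alpha i *~ n i = 0)%R -> forall i, n i = 0%R)
    (g : 'I_m -> iet R) (g_in : forall j, @G1q R q (g j))
    (F : finGroupType) (F_abelian : abelian [set: F])
    (F_def : isomorphic (abelianization (Hgrp alpha g))
                        (F * Agrp alpha)%type) :
  let Q : groupClosed (iet R) := gen (range g)%classic in
  let SQ : {group 'S_q} := symg_group q Q in
  let W : {group 'S_q} := (SQ <*> <[sigma q]>)%G in
  [/\ [~: W, W] :&: SQ = [~: SQ, SQ] -> [set: F] \isog SQ / [~: SQ, SQ],
      sigma q \in SQ -> [set: F] \isog SQ / [~: SQ, SQ],
      forall tau : 'S_q, SQ :=: <[tau]> -> tau \notin 'Alt_('I_q) ->
        #[tau] = 2%N -> [set: F] \isog SQ,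
      SQ :=: [~: SQ, SQ] -> [set: F] = 1 &
      (5 <= q)%N -> SQ :=: 'Alt_('I_q) -> [set: F] = 1].
Proof.
move=> Q SQ W.
have W_id : sigma q \in SQ -> W :=: SQ.
  by move=> sigmaSQ; apply/joing_idPl; rewrite cycle_subG.
have [rho [rhoT ker_sub]] : exists rho : {morphism SQ >-> F},
    rho @* SQ = [set: F] /\ 'ker rho \subset [~: W, W].
  by have := torsion_quotient q_gt0 alpha_free g_in F_abelian F_def.
clearbody W; clearbody SQ.
have ker_SQ : 'ker rho \subset SQ by exact: subsetIl.
have der_ker : [~: SQ, SQ] \subset 'ker rho.
  apply: der1_min (ker_norm rho) _.
  by rewrite (isog_abelian (first_isog rho)) /= rhoT.
have F_isog : [set: F] \isog SQ / 'ker rho.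
  by have := first_isog rho; rewrite /= rhoT isog_sym.
have part1 : [~: W, W] :&: SQ = [~: SQ, SQ] -> [set: F] \isog SQ / [~: SQ, SQ].
  move=> WSQ; have -> // : [~: SQ, SQ] = 'ker rho.
  by apply/eqP; rewrite finset.eqEsubset der_ker -WSQ finset.subsetI ker_sub.
have part3 : SQ :=: [~: SQ, SQ] -> [set: F] = 1.
  move=> SQ_perfect; apply/eqP; rewrite (isog_eq1 F_isog); apply/eqP/quotientS1.
  by move: der_ker; rewrite -SQ_perfect.
split=> // [sigmaSQ|tau SQE tau_odd tau2|q5 SQE].
- apply: part1; rewrite W_id//.
  by apply/finset.setIidPl; exact: (der_sub 1).
- have ker1 : 'ker rho = 1.
    apply/trivgP/fintype.subsetP => x kx; rewrite inE.
    have := fintype.subsetP ker_SQ _ kx; rewrite SQE cycle2g// !inE => /orP[//|/eqP xE].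
    move/fintype.subsetP/(_ _ kx): ker_sub => /(fintype.subsetP (der_even _)).
    by rewrite xE (negbTE tau_odd).
  have := sub_isog (subxx SQ) (introT trivgP ker1 : 'injm rho).
  by rewrite rhoT isog_sym.
- by apply: part3; rewrite SQE -Alt_perfect ?card_ord.
Qed.
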